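(* Let $n\ge1$ be an integer and let $$x_j=\cos\left(\frac{j\pi}{n}+\varepsilon_j\right),\qquad j=0,\ldots,n,$$ be distinct points, with $\varepsilon_j\in\mathbb{R}$, $\varepsilon_0=\varepsilon_n=0$ and $\max_{0\le j\le n}|\varepsilon_j|\le\sigma_n$. Let $\eta$ be a constant satisfying $$0<\eta<\left(1+\frac{2}{\pi}\right)^{-1},$$ and assume that $$n\sigma_n(\log n+1)\le\eta .$$ Then the Lebesgue constant $\Lambda_n$ of the nodes $\{x_0,\ldots,x_n\}$ satisfies $$\Lambda_n\le C_\eta(\log n+1),\qquad C_\eta=\frac{1+\frac{2}{\pi}}{1-\left(1+\frac{2}{\pi}\right)\eta}.$$ In particular, if for each $n$ one is given such a set of distinct perturbed nodes (with $\varepsilon_j$ depending on $n$, $\varepsilon_0=\varepsilon_n=0$ and $\max_j|\varepsilon_j|\le\sigma_n$) and $n\sigma_n\log n\to0$ as $n\to\infty$, then $\Lambda_n=O(\log n)$ as $n\to\infty$.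
   Context: $\log$ denotes the natural logarithm. For a set of distinct nodes $\{x_0,\ldots,x_n\}\subset[-1,1]$, the Lagrange basis polynomials are $\ell_j(x)=\prod_{k\ne j}\frac{x-x_k}{x_j-x_k}$, $j=0,\ldots,n$, and the Lebesgue constant of the node set is $\Lambda_n=\max_{x\in[-1,1]}\sum_{j=0}^n|\ell_j(x)|$. *)

(* Defs.v *)
From mathcomp Require Import all_boot all_order all_algebra.
From mathcomp Require Import all_classical all_reals all_analysis.
Set Implicit Arguments.
Unset Strict Implicit.
Unset Printing Implicit Defensive.
Import Order.TTheory GRing.Theory Num.Theory numFieldNormedType.Exports.
Local Open Scope classical_set_scope.
Local Open Scope ring_scope.

Definition lagrange_basis (R : realType) (n : nat) (x : 'I_n.+1 -> R)
    (j : 'I_n.+1) (t : R) : R :=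
  \prod_(k < n.+1 | k != j) ((t - x k) / (x j - x k)).

Definition lebesgue_function (R : realType) (n : nat) (x : 'I_n.+1 -> R)
    (t : R) : R :=
  \sum_(j < n.+1) `|lagrange_basis x j t|.

(* The supremum is a maximum, see lebesgue_constant_max. *)
Definition lebesgue_constant (R : realType) (n : nat) (x : 'I_n.+1 -> R) : R :=
  sup [set lebesgue_function x t | t in `[-1, 1]].

Definition perturbed_node (R : realType) (n : nat) (eps : 'I_n.+1 -> R)
    (j : 'I_n.+1) : R :=
  cos (j%:R * pi / n%:R + eps j).

Definition admissible_perturbation (R : realType) (n : nat)
    (eps : 'I_n.+1 -> R) (sigma : R) : Prop :=
  [/\ eps ord0 = 0, eps ord_max = 0, (forall j, `|eps j| <= sigma) &
      injective (perturbed_node eps)].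

Lemma lebesgue_function_continuous (R : realType) (n : nat)
  (x : 'I_n.+1 -> R) : continuous (lebesgue_function x).
Proof.
apply: (@continuous_big _ _ _ _ _ (@add_continuous R^o)) => j _ t.
apply: (@cvg_norm _ R^o); move: t.
apply: (@continuous_big _ _ _ _ _ (@mul_continuous R)) => k _ t.
by apply: cvgMl; apply: (@cvgB _ R^o); [exact: cvg_id|exact: cvg_cst].
Qed.

Lemma lebesgue_constant_max (R : realType) (n : nat) (x : 'I_n.+1 -> R) :
  exists2 c, c \in `[-1, 1] & lebesgue_constant x = lebesgue_function x c /\
    forall t, t \in `[-1, 1] -> lebesgue_function x t <= lebesgue_function x c.
Proof.
have le11 : -1 <= 1 :> R by rewrite (le_trans (lerN10 _)) ?ler01.
have [|c c11 maxc] := @EVT_max R (lebesgue_function x) _ _ le11.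
  by apply: continuous_subspaceT => t; exact: lebesgue_function_continuous.
exists c => //; split=> //; apply/eqP; rewrite eq_le; apply/andP; split.
  apply: ge_sup; first by exists (lebesgue_function x c), c.
  by move=> _ [t t11 <-]; exact: maxc.
apply: ub_le_sup; last by exists c.
by exists (lebesgue_function x c) => _ [t t11 <-]; exact: maxc.
Qed.

(* Main.v *)
Require Import Defs.
From mathcomp Require Import all_boot all_order all_algebra.
From mathcomp Require Import all_classical all_reals all_analysis.
From mathcomp Require Import ring lra zify.
Import Order.TTheory GRing.Theory Num.Theory numFieldNormedType.Exports.
Local Open Scope classical_set_scope.
Local Open Scope ring_scope.
Set Implicit Arguments.
Unset Strict Implicit.
Unset Printing Implicit Defensive.

(** Let [p] be the signed sum of the Lagrange polynomials of the perturbed nodes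
that attains the Lebesgue constant [L], so that [|p| <= L] on [-1, 1] and
[|p| <= 1] at the nodes. With [q t = p (cos t)], Bernstein's inequality makes
[q] Lipschitz with constant [n * L], hence [|q| <= 1 + n * sigma * L] at the
angles [j * pi / n]. Interpolation at these unperturbed angles has Lebesgue
constant at most [(1 + 2 / pi) * (ln n + 1)], which gives
[L <= (1 + n * sigma * L) * (1 + 2 / pi) * (ln n + 1)].

One kernel serves both steps: [interp_kernel] interpolates trigonometric
polynomials on the grid [k * pi / n], which bounds [q] by its grid values, and
on the grid shifted by [pi / (2 n)] it yields M. Riesz's proof of Bernstein's
inequality. *)

(** * Elementary trigonometric inequalities and identities *)

Lemma is_derive_ge0_le (R : realType) (f g : R -> R) (a b : R) :
  a <= b -> (forall y : R, is_derive y (1 : R) f (g y)) ->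
  (forall y, a < y -> y < b -> 0 <= g y) -> f a <= f b.
Proof.
move=> ab df g0; apply: (@ger0_derive1_le_cc R f a b) => //.
- move=> y; rewrite in_itv /= => /andP[ay yb].
  by rewrite derive1E derive_val g0.
- apply: continuous_subspaceT => y.
  by apply: differentiable_continuous; apply/derivable1_diffP.
- by rewrite in_itv /= lexx.
- by rewrite in_itv /= lexx ab.
Qed.

Lemma sin_le_id (R : realType) (x : R) : 0 <= x -> sin x <= x.
Proof.
move=> x0; rewrite -subr_ge0.
have df (y : R) : is_derive y 1 (fun z => z - sin z) (1 - cos y).
  exact: is_deriveB.
have := is_derive_ge0_le x0 df; rewrite sin0 subrr; apply=> y _ _.
by rewrite subr_ge0 cos_le1.
Qed.

(** The bound [x cot x <= 1] cleared of its denominator, which drives the decay of the kernel; the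
    difference of the two sides has derivative [x * sin x]. *)
Lemma mulr_cos_le_sin (R : realType) (x : R) :
  0 <= x -> x <= pi -> x * cos x <= sin x.
Proof.
move=> x0 xpi; rewrite -subr_ge0.
have df (y : R) : is_derive y 1 (fun z => sin z - z * cos z) (y * sin y).
  by apply: is_derive_eq; rewrite /GRing.scale /=; ring.
have := is_derive_ge0_le x0 df; rewrite sin0 mul0r subrr; apply=> y y0 yx.
rewrite mulr_ge0 ?(ltW y0)// sin_ge0_pi//.
by rewrite (ltW y0) (le_trans (ltW yx)).
Qed.

Lemma mulr2_cos_cos (R : realType) (a b : R) :
  2 * (cos a * cos b) = cos (a + b) + cos (a - b).
Proof. by rewrite cosD cosB; ring. Qed.

Lemma mulr2_sin_cos (R : realType) (a b : R) :
  2 * (sin a * cos b) = sin (a + b) + sin (a - b).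
Proof. by rewrite sinD sinB; ring. Qed.

Lemma cosD_natr_pi2 (R : realType) (x : R) (k : nat) :
  cos (x + k%:R * (pi *+ 2)) = cos x.
Proof. by rewrite mulr_natl (periodicn (@cosD2pi R)). Qed.

Lemma sinD_natr_pi2 (R : realType) (x : R) (k : nat) :
  sin (x + k%:R * (pi *+ 2)) = sin x.
Proof. by rewrite mulr_natl (periodicn (@sinD2pi R)). Qed.

Lemma sinD_natr_pi (R : realType) (x : R) (k : nat) :
  sin (x + k%:R * pi) = (-1) ^+ k * sin x.
Proof. by rewrite mulr_natl (alternatingn (@sinDpi R)). Qed.

(** * Discrete orthogonality of cosines on the grid *)

(** The indices [k < n + n] cover one full period; those with [k <= n] give the unperturbed
    angles. *)
Definition grid_angle (R : realType) (n k : nat) : R := k%:R * pi / n%:R.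

(** Multiplied by [2 * sin h], where [h] is half the angular step, the sum telescopes, and its two
    end terms differ by [r] full turns. The bounds on [r] put [h] strictly between 0 and [pi], so
    [sin h] can be cancelled. *)
Lemma sum_cos_grid (R : realType) (n r : nat) (b : R) :
  (0 < r)%N -> (r < n + n)%N ->
  \sum_(k < n + n) cos (b + r%:R * grid_angle R n k) = 0.
Proof.
move=> r0 rn.
have n0 : (0 < n)%N by lia.
have nR : (n%:R : R) != 0 by rewrite pnatr_eq0 -lt0n.
pose h : R := r%:R * pi / (2 * n%:R).
have sh : 0 < sin h.
  apply: sin_gt0_pi; rewrite /h.
  have pi0 := pi_gt0 R.
  have n2 : 0 < 2 * n%:R :> R by rewrite mulr_gt0 // ltr0n.
  rewrite divr_gt0 ?mulr_gt0 ?ltr0n//= ltr_pdivrMr // mulrC ltr_pM2l //.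
  by rewrite -natrM ltr_nat; lia.
apply: (mulfI (lt0r_neq0 sh)); apply: (@mulfI _ 2) => //.
rewrite !mulr0 big_distrr big_distrr /=.
rewrite -(big_mkord xpredT (fun k : nat =>
  2 * (sin h * cos (b + r%:R * grid_angle R n k)))) /=.
pose f (k : nat) : R := sin (b + (k%:R *+ 2 - 1) * h).
rewrite (@telescope_sumr_eq _ 0 _ f) //; last first.
  move=> k _; rewrite mulr2_sin_cos /f /grid_angle.
  have -> : h + (b + r%:R * (k%:R * pi / n%:R)) =
     b + (k.+1%:R *+ 2 - 1) * h.
    by rewrite /h -natr1; field.
  have -> : h - (b + r%:R * (k%:R * pi / n%:R)) =
     - (b + (k%:R *+ 2 - 1) * h).
    by rewrite /h; field.
  by rewrite sinN.
rewrite /f.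
have -> : b + ((n + n)%:R *+ 2 - 1) * h =
   b + (0%:R *+ 2 - 1) * h + r%:R * (pi *+ 2).
  by rewrite /h natrD; field.
by rewrite sinD_natr_pi2 subrr.
Qed.

Lemma sum_cosB_grid (R : realType) (n r : nat) (b : R) :
  (0 < r)%N -> (r < n + n)%N ->
  \sum_(k < n + n) cos (b - r%:R * grid_angle R n k) = 0.
Proof.
move=> r0 rn; rewrite -[RHS](@sum_cos_grid R n r (- b)) //.
by apply: eq_bigr => k _; rewrite -[in RHS]cosN; congr cos; ring.
Qed.

(** Product-to-sum leaves the frequencies [l - m] and [l + m]. The second one aliases to a constant
    only if [l + m] is 0 or [2 n], that is, at the end frequencies. The phase [al] covers cosines
    and sines at once. *)
Lemma sum_cos_cos_grid (R : realType) (n l m : nat) (th al : R) :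
  (0 < n)%N -> (l <= n)%N -> (m <= n)%N ->
  \sum_(k < n + n) cos (l%:R * (th - grid_angle R n k)) *
      cos (m%:R * grid_angle R n k + al) =
  n%:R * ((l == m)%:R * (cos (m%:R * th + al) +
    ((m == 0)%N || (m == n))%:R * cos (m%:R * th - al))).
Proof.
move=> n0 ln mn; apply: (@mulfI _ 2) => //.
have -> : (l == m)%:R * (cos (m%:R * th + al) +
      ((m == 0)%N || (m == n))%:R * cos (m%:R * th - al)) =
    (l == m)%:R * cos (m%:R * th + al) +
    ((l + m == 0)%N || (l + m == n + n)%N)%:R * cos (l%:R * th - al).
  rewrite mulrDr; congr (_ + _); have [->|lm] := eqVneq l m.
    rewrite mul1r; congr (_%:R * _); lia.
  suff -> : (l + m == 0)%N || (l + m == n + n)%N = false by rewrite !mul0r.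
  by move/eqP: lm; lia.
have nR : (n%:R : R) != 0 by rewrite pnatr_eq0 -lt0n.
rewrite big_distrr /=.
under eq_bigr do rewrite mulr2_cos_cos.
rewrite big_split /= mulrA mulrDr; congr (_ + _).
- have [->|lm] := eqVneq l m.
    under eq_bigr do rewrite mulrBr addrA subrK.
    by rewrite sumr_const card_ord mul1r -[LHS]mulr_natl natrD; ring.
  rewrite mul0r mulr0.
  have [lt_lm|lt_ml|/eqP] := ltngtP l m; last by rewrite (negbTE lm).
  + rewrite -[RHS](@sum_cos_grid R n (m - l) (l%:R * th + al)); [|lia|lia].
    apply: eq_bigr => k _; congr cos; rewrite natrB; [ring|lia].
  + rewrite -[RHS](@sum_cosB_grid R n (l - m) (l%:R * th + al)); [|lia|lia].
    apply: eq_bigr => k _; congr cos; rewrite natrB; [ring|lia].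
- have [lm0|lm0] := eqVneq (l + m)%N 0%N.
    have -> : l = 0%N by lia.
    have -> : m = 0%N by lia.
    under eq_bigr do rewrite !mul0r.
    rewrite !mul0r !add0r sumr_const card_ord -[LHS]mulr_natl natrD.
    by rewrite /=; ring.
  have [lmn|lmn] := eqVneq (l + m)%N (n + n)%N; last first.
    rewrite mul0r mulr0.
    rewrite -[RHS](@sum_cosB_grid R n (l + m) (l%:R * th - al)); [|lia|lia].
    by apply: eq_bigr => k _; congr cos; rewrite natrD; ring.
  have -> : l = n by lia.
  have -> : m = n by lia.
  rewrite (eq_bigr (fun=> cos (n%:R * th - al))); last first.
    move=> k _; rewrite -[LHS](@cosD_natr_pi2 R _ k); congr cos.
    by rewrite /grid_angle; field.
  by rewrite sumr_const card_ord -[LHS]mulr_natl natrD /=; ring.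
Qed.

(** * The interpolation kernel: closed form, bounds and reproduction of cosines *)

(* Equals [sin (n t) cot (t / 2) / (2 n)], see [interp_kernel_sin], without the
   singularities at the multiples of [2 pi]. *)
Definition interp_kernel (R : realType) (n : nat) (t : R) : R :=
  (\sum_(m < n) (cos (m%:R * t) + cos (m.+1%:R * t))) / (2 * n%:R).

Lemma interp_kernelN (R : realType) (n : nat) (t : R) :
  interp_kernel n (- t) = interp_kernel n t.
Proof.
by congr (_ / _); apply: eq_bigr => m _; rewrite !mulrN !cosN.
Qed.

Lemma interp_kernelD2pi (R : realType) (n : nat) (t : R) :
  interp_kernel n (t + pi *+ 2) = interp_kernel n t.
Proof.
by congr (_ / _); apply: eq_bigr => m _; rewrite !(mulrDr _ t) !cosD_natr_pi2.
Qed.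

Lemma interp_kernel_sin (R : realType) (n : nat) (t : R) : (0 < n)%N ->
  2 * n%:R * (interp_kernel n t * sin (t / 2)) = sin (n%:R * t) * cos (t / 2).
Proof.
move=> n0; rewrite /interp_kernel.
have nR : (n%:R : R) != 0 by rewrite pnatr_eq0 -lt0n.
set S := \sum_(_ < _) _.
have -> : 2 * n%:R * (S / (2 * n%:R) * sin (t / 2)) = S * sin (t / 2) by field.
rewrite {}/S; elim: n {n0 nR} => [|n IH].
  by rewrite big_ord0 !mul0r sin0 mul0r.
rewrite big_ord_recr /= mulrDl IH -(natr1 n).
(* With [n t = u - h] and [(n + 1) t = u + h] the induction step is a polynomial identity in the
   sines and cosines of [u] and [h]. *)
have [h ->] : exists h, t = h + h by exists (t / 2); field.
have -> : (h + h) / 2 = h by field.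
have [u nu] : exists u, n%:R * (h + h) = u - h.
  by exists (n%:R * (h + h) + h); ring.
have -> : (n%:R + 1) * (h + h) = u + h by rewrite mulrDl nu; ring.
by rewrite nu sinB cosB sinD cosD; ring.
Qed.

Lemma interp_kernel_le1 (R : realType) (n : nat) (t : R) : (0 < n)%N ->
  `|interp_kernel n t| <= 1.
Proof.
move=> n0; have n2 : 0 < 2 * n%:R :> R by rewrite mulr_gt0 // ltr0n.
rewrite /interp_kernel normrM normfV (gtr0_norm n2) ler_pdivrMr // mul1r.
apply: (le_trans (ler_norm_sum _ _ _)).
rewrite (le_trans (ler_sum (G := fun=> 2) _ _)) //.
  move=> m _; apply: (le_trans (ler_normD _ _)).
  by rewrite (_ : 2 = 1 + 1) // lerD // cos_max.
by rewrite sumr_const card_ord -[leLHS]mulr_natr.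
Qed.

Lemma interp_kernel_le_inv (R : realType) (n : nat) (t : R) : (0 < n)%N ->
  0 < t -> t <= pi -> `|interp_kernel n t| <= (n%:R * t)^-1.
Proof.
move=> n0 t0 tpi.
have pi0 := pi_gt0 R.
have nR : 0 < n%:R :> R by rewrite ltr0n.
have nt : 0 < n%:R * t by rewrite mulr_gt0.
have E := @interp_kernel_sin R n t n0.
have s0 : 0 < sin (t / 2) by apply: sin_gt0_pi; lra.
rewrite -[_^-1]mul1r ler_pdivlMr //.
(* At [t = pi] the factor [cos (t / 2)], cancelled below, vanishes; the kernel itself is 0 there. *)
have [teq|tne] := eqVneq t pi.
  move: E; rewrite teq cos_pihalf mulr0 sin_pihalf mulr1 => /eqP.
  rewrite mulf_eq0 => /orP[|/eqP->]; last by rewrite normr0 mul0r.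
  by rewrite mulf_eq0 pnatr_eq0 /= (gt_eqF nR).
have tlt : t < pi by rewrite lt_neqAle tne.
have c0 : 0 < cos (t / 2) by apply: cos_gt0_pihalf; lra.
have tc : t / 2 * cos (t / 2) <= sin (t / 2) by apply: mulr_cos_le_sin; lra.
have A : 2 * n%:R * (`|interp_kernel n t| * sin (t / 2)) <= cos (t / 2).
  rewrite -(gtr0_norm s0) -[2 * n%:R]gtr0_norm ?mulr_gt0 // -!normrM E normrM.
  by rewrite (gtr0_norm c0) ler_piMl ?(ltW c0) // sin_max.
rewrite -(ler_pM2r c0) mul1r (le_trans _ A) //.
have -> : `|interp_kernel n t| * (n%:R * t) * cos (t / 2) =
  2 * (`|interp_kernel n t| * n%:R) * (t / 2 * cos (t / 2)) by field.
have -> : 2 * n%:R * (`|interp_kernel n t| * sin (t / 2)) =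
  2 * (`|interp_kernel n t| * n%:R) * sin (t / 2) by ring.
by rewrite ler_wpM2l // !mulr_ge0 // ltW.
Qed.

Lemma sum_nat_delta (R : realType) (n m : nat) (a : R) :
  \sum_(l < n) (l == m :> nat)%:R * a = (m < n)%N%:R * a.
Proof.
elim: n => [|n IH]; first by rewrite big_ord0 mul0r.
rewrite big_ord_recr /= IH -mulrDl -natrD; congr (_%:R * _); lia.
Qed.

(* At [m = n] the grid sees only the cosine part, since [sin (n t)] vanishes on
   it. *)
Lemma interp_kernel_cos (R : realType) (n m : nat) (th al : R) :
  (0 < n)%N -> (m <= n)%N ->
  \sum_(k < n + n) interp_kernel n (th - grid_angle R n k) *
      cos (m%:R * grid_angle R n k + al) =
  if (m < n)%N then cos (m%:R * th + al) else cos (n%:R * th) * cos al.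
Proof.
move=> n0 mn.
have nR : (n%:R : R) != 0 by rewrite pnatr_eq0 -lt0n.
set c := cos (m%:R * th + al) +
  ((m == 0)%N || (m == n))%:R * cos (m%:R * th - al).
transitivity ((2 * n%:R)^-1 * \sum_(l < n)
    ((l == m :> nat)%:R * (n%:R * c) + (l.+1 == m :> nat)%:R * (n%:R * c))).
  rewrite /interp_kernel.
  under eq_bigr do rewrite mulrAC mulrC big_distrl /=.
  rewrite -big_distrr exchange_big /=; congr (_ * _).
  apply: eq_bigr => l _.
  under eq_bigr do rewrite mulrDl.
  rewrite big_split /= !sum_cos_cos_grid //; last exact: ltnW.
  by congr (_ + _); rewrite mulrCA.
rewrite big_split /= sum_nat_delta.
have -> : \sum_(l < n) (l.+1 == m)%:R * (n%:R * c) = (0 < m)%N%:R * (n%:R * c).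
  move: (n%:R * c) => a; case: m {c} mn => [|m] mn.
    by rewrite big1 => [|l _]; rewrite /= mul0r.
  by under eq_bigr do rewrite eqSS; rewrite sum_nat_delta mn.
(* A frequency [0 < m < n] is met twice, at [l = m] and at [l.+1 = m]. The end frequencies are met
   once, and the aliasing term in [c] supplies the second copy. *)
rewrite -mulrDl /c; case: ifP => mltn.
  have -> : (m == n) = false by lia.
  rewrite orbF; case: (posnP m) => [->|m0].
    by rewrite !mul0r add0r sub0r cosN /=; field.
  by rewrite mul0r addr0 /=; field.
have -> : m = n by lia.
rewrite eqxx orbT n0 cosD cosB /=; field.
by [].
Qed.

(** * Bernstein's inequality by Riesz's method *)

(** A sine is a cosine with phase [- pi / 2]. The shift by [pi / (2 n)] makes the total phase vanish
    at [m = n], so the top sine is reproduced too. *)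
Lemma interp_kernel_sin_mid (R : realType) (n m : nat) (th : R) :
  (0 < n)%N -> (m <= n)%N ->
  \sum_(k < n + n) interp_kernel n (th - (grid_angle R n k + pi / (2 * n%:R))) *
      sin (m%:R * (grid_angle R n k + pi / (2 * n%:R))) = sin (m%:R * th).
Proof.
move=> n0 mn.
have nR : (n%:R : R) != 0 by rewrite pnatr_eq0 -lt0n.
set phi := pi / (2 * n%:R).
transitivity (\sum_(k < n + n) interp_kernel n ((th - phi) - grid_angle R n k) *
      cos (m%:R * grid_angle R n k + (m%:R * phi - pi / 2))).
  apply: eq_bigr => k _; rewrite -cosBpihalf; congr (interp_kernel _ _ * cos _); ring.
rewrite interp_kernel_cos //; case: ifP => mltn.
  by rewrite -[RHS]cosBpihalf; congr cos; ring.
have -> : m = n by lia.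
have -> : n%:R * phi - pi / 2 = 0 by rewrite /phi; field.
by rewrite cos0 mulr1 -cosBpihalf; congr cos; rewrite /phi; field.
Qed.

(** Both [sin (n (u - d))] and [sin (n (u + d))] equal [(-1) ^+ k * cos (n d)], so the closed form
    leaves a difference of cotangents of [(u - d) / 2] and [(u + d) / 2]. Over the common
    denominator, which is positive since [0 < u - d] and [u + d < 2 pi], the numerator is
    [cos (n d) * sin d]. *)
Lemma interp_kernel_mid_sign (R : realType) (n k : nat) (d u : R) :
  (0 < n)%N -> (k < n + n)%N -> 0 < d -> n%:R * d < 1 ->
  u = grid_angle R n k + pi / (2 * n%:R) ->
  0 <= (-1) ^+ k * (interp_kernel n (d - u) - interp_kernel n (d + u)).
Proof.
move=> n0 kn d0 nd1 uE.
have nR : 0 < n%:R :> R by rewrite ltr0n.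
have pi2 := pi_ge2 R.
have pi0 := pi_gt0 R.
have nu : n%:R * u = k%:R * pi + pi / 2.
  by rewrite uE /grid_angle; field; rewrite gt_eqF.
have k2n : k%:R + 1 <= 2 * n%:R :> R.
  by rewrite natr1 -natrM ler_nat; lia.
have kpi : 0 <= k%:R * pi :> R by rewrite mulr_ge0 // ltW.
have ud : d < u by rewrite -(ltr_pM2l nR) nu; lra.
have ud2 : u + d < 2 * pi.
  rewrite -(ltr_pM2l nR) mulrDr nu.
  have : (k%:R + 1) * pi <= 2 * n%:R * pi :> R by rewrite ler_pM2r.
  lra.
have sA : 0 < sin ((u - d) / 2) by apply: sin_gt0_pi; lra.
have sB : 0 < sin ((u + d) / 2) by apply: sin_gt0_pi; lra.
have EA := interp_kernel_sin (u - d) n0.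
have EB := interp_kernel_sin (u + d) n0.
have nA : sin (n%:R * (u - d)) = (-1) ^+ k * cos (n%:R * d).
  rewrite mulrBr nu -cosN -sinDpihalf -sinD_natr_pi; congr sin; ring.
have nB : sin (n%:R * (u + d)) = (-1) ^+ k * cos (n%:R * d).
  rewrite mulrDr nu -sinDpihalf -sinD_natr_pi; congr sin; ring.
have c0 : 0 <= cos (n%:R * d).
  by apply: cos_ge0_pihalf; have := mulr_gt0 nR d0; lra.
have sd : 0 <= sin d.
  apply: sin_ge0_pi; rewrite ltW //=.
  have : 1 <= n%:R :> R by rewrite ler1n.
  by nra.
rewrite -(interp_kernelN _ (d - u)) opprB (addrC d).
have s2 : (-1) ^+ k * (-1) ^+ k = 1 :> R by rewrite -exprMn mulrNN mulr1 expr1n.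
have pos : 0 < 2 * n%:R * (sin ((u - d) / 2) * sin ((u + d) / 2)).
  by rewrite !mulr_gt0.
set KA := interp_kernel n (u - d) in EA *.
set KB := interp_kernel n (u + d) in EB *.
rewrite -(pmulr_lge0 _ pos).
suff -> : (-1) ^+ k * (KA - KB) *
    (2 * n%:R * (sin ((u - d) / 2) * sin ((u + d) / 2))) = cos (n%:R * d) * sin d.
  exact: mulr_ge0.
have -> : sin d = sin ((u + d) / 2 - (u - d) / 2) by congr sin; field.
rewrite sinB.
transitivity ((-1) ^+ k * ((2 * n%:R * (KA * sin ((u - d) / 2))) * sin ((u + d) / 2)
   - (2 * n%:R * (KB * sin ((u + d) / 2))) * sin ((u - d) / 2))); first by ring.
rewrite EA EB nA nB.
transitivity ((-1) ^+ k * (-1) ^+ k * (cos (n%:R * d) *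
  (sin ((u + d) / 2) * cos ((u - d) / 2) - cos ((u + d) / 2) * sin ((u - d) / 2)))).
  by ring.
by rewrite s2 mul1r.
Qed.

(* By [interp_kernel_mid_sign] the interpolation weights have the signs of
   [sin (n u_k)], so their absolute sum is the interpolant of [sin (n t)]. *)
Lemma sine_poly_le (R : realType) (n : nat) (b : 'I_n.+1 -> R) (B d : R) :
  (0 < n)%N -> 0 < d -> n%:R * d < 1 ->
  (forall t, `|\sum_(m < n.+1) b m * sin (m%:R * t)| <= B) ->
  `|\sum_(m < n.+1) b m * sin (m%:R * d)| <= B * sin (n%:R * d).
Proof.
move=> n0 d0 nd1; set f := fun t => \sum_(m < n.+1) b m * sin (m%:R * t).
rewrite -/(f d) => fB.
have nR : 0 < n%:R :> R by rewrite ltr0n.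
pose u (k : nat) := grid_angle R n k + pi / (2 * n%:R).
(* Since [f] is odd, subtracting its interpolants at [d] and [- d] gives [2 * f d] with weights of
   known sign. *)
pose w (k : nat) := interp_kernel n (d - u k) - interp_kernel n (d + u k).
have wS (m : nat) : (m <= n)%N ->
    \sum_(k < n + n) w k * sin (m%:R * u k) = 2 * sin (m%:R * d).
  move=> mn; under eq_bigr do rewrite mulrBl.
  rewrite sumrB interp_kernel_sin_mid //.
  have := @interp_kernel_sin_mid R n m (- d) n0 mn.
  under eq_bigr do rewrite -(interp_kernelN _ (- d - _)) opprB opprK addrC.
  by rewrite mulrN sinN => ->; ring.
have fw : 2 * f d = \sum_(k < n + n) w k * f (u k).
  under [RHS]eq_bigr do rewrite big_distrr /=.
  rewrite exchange_big big_distrr /=; apply: eq_bigr => m _.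
  under eq_bigr do rewrite mulrCA.
  by rewrite -[RHS]big_distrr /= wS -1?ltnS // mulrCA.
have w_abs (k : 'I_(n + n)) : `|w k| = w k * sin (n%:R * u k).
  have -> : sin (n%:R * u k) = (-1) ^+ k.
    transitivity ((-1) ^+ k * sin (pi / 2) : R); last first.
      by rewrite sin_pihalf mulr1.
    rewrite -sinD_natr_pi; congr sin.
    by rewrite /u /grid_angle; field; rewrite gt_eqF.
  have w0 := interp_kernel_mid_sign n0 (ltn_ord k) d0 nd1 (erefl (u k)).
  by rewrite mulrC -[RHS]ger0_norm // normrM normrX normrN1 expr1n mul1r.
rewrite -(@ler_pM2l _ 2) // -[2 in leLHS]ger0_norm // -normrM fw.
apply: (le_trans (ler_norm_sum _ _ _)).
rewrite mulrCA -wS // big_distrr /=; apply: ler_sum => k _.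
by rewrite normrM -w_abs mulrC ler_wpM2r //; exact: fB.
Qed.

(** Bernstein's inequality in integrated form, without derivatives: the centred difference
    [q (s + d) - q (s - d)] is a sine polynomial in [d] bounded by [2 * M], hence at most
    [2 * M * sin (n d)]. *)
Lemma cosine_poly_lipschitz (R : realType) (n : nat) (c : 'I_n.+1 -> R)
    (q : R -> R) (M a e : R) : (0 < n)%N ->
  (forall t, q t = \sum_(m < n.+1) c m * cos (m%:R * t)) ->
  (forall t, `|q t| <= M) -> `|q (a + e) - q a| <= n%:R * `|e| * M.
Proof.
move=> n0 qE qM.
have nR : 0 < n%:R :> R by rewrite ltr0n.
have M0 : 0 <= M by exact: le_trans (qM 0).
have q2M s t : `|q s - q t| <= 2 * M.
  apply: (le_trans (ler_normB _ _)); have := qM s; have := qM t; lra.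
have sym s d : 0 <= d -> `|q (s + d) - q (s - d)| <= n%:R * (2 * d) * M.
  rewrite le_eqVlt => /predU1P[<-|d0].
    by rewrite addr0 subr0 subrr normr0 !mulr0 mul0r.
  (* For [n d >= 1] the trivial bound [2 * M] is enough. *)
  have [nd1|nd1] := ltP (n%:R * d) 1; last first.
    by apply: (le_trans (q2M _ _)); nra.
  have diffE t : q (s + t) - q (s - t) =
      \sum_(m < n.+1) (- 2 * c m * sin (m%:R * s)) * sin (m%:R * t).
    rewrite !qE -sumrB; apply: eq_bigr => m _.
    by rewrite mulrDr mulrBr cosD cosB; ring.
  have := sine_poly_le (B := 2 * M) n0 d0 nd1 _.
  rewrite diffE => /(_ (fun m => - 2 * c m * sin (m%:R * s))).
  move=> /(_ _)/le_trans-> //; first by move=> t; rewrite -diffE.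
  have := @sin_le_id R (n%:R * d) (ltW (mulr_gt0 nR d0)); nra.
have [e0|e0] := leP 0 e.
  have := sym (a + e / 2) (e / 2); rewrite (ger0_norm e0).
  have -> : a + e / 2 + e / 2 = a + e by field.
  have -> : a + e / 2 - e / 2 = a by ring.
  have -> : 2 * (e / 2) = e by field.
  by apply; rewrite divr_ge0.
have := sym (a + e / 2) (- e / 2); rewrite (ltr0_norm e0) distrC.
have -> : a + e / 2 - (- e / 2) = a + e by field.
have -> : a + e / 2 + (- e / 2) = a by ring.
have -> : 2 * (- e / 2) = - e by field.
by apply; rewrite divr_ge0 // oppr_ge0 ltW.
Qed.

(** * The Lebesgue constant of the unperturbed angles *)

(** Each new term satisfies [1 / (n + 1) <= 2 / (n + 2) <= 2 * ln ((n + 2) / (n + 1))]. The crude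
    factor 2 avoids an additive constant. *)
Lemma sum_harmonic_le_ln (R : realType) (n : nat) :
  \sum_(j < n) (j.+1%:R)^-1 <= 2 * ln (n.+1%:R) :> R.
Proof.
elim: n => [|n IH]; first by rewrite big_ord0 ln1 mulr0.
rewrite big_ord_recr /=.
have p1 : 0 < n.+1%:R :> R by rewrite ltr0n.
have p2 : 0 < n.+2%:R :> R by rewrite ltr0n.
have E2 : n.+2%:R = n.+1%:R + 1 :> R by rewrite natr1.
have n1 : 1 <= n.+1%:R :> R by rewrite ler1n.
have lnE : ln n.+1%:R = ln n.+2%:R + ln (1 + - (n.+2%:R)^-1) :> R.
  rewrite -lnM ?posrE // ?subr_gt0 ?invf_lt1 ?ltr1n //.
  congr ln; rewrite E2; move: (n.+1%:R : R) p1 => a a0; field.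
  by apply: lt0r_neq0; lra.
have := @le_ln1Dx R (- (n.+2%:R)^-1) _.
rewrite ltrN2 invf_lt1 // ltr1n => /(_ isT) H.
have : (n.+1%:R)^-1 <= 2 * (n.+2%:R)^-1 :> R.
  rewrite -[_^-1]mul1r ler_pdivrMr // mulrAC ler_pdivlMr //; lra.
move=> inv_le; apply: (le_trans (lerD IH inv_le)).
by rewrite -mulrDr ler_pM2l // lnE -addrA gerDl -lerBrDr sub0r.
Qed.

(** The Lebesgue function of interpolation on the full grid; the plus sign is harmless, as the
    kernel is even and the grid is symmetric modulo [2 pi]. *)
Definition kernel_sum (R : realType) (n : nat) (th : R) : R :=
  \sum_(k < n + n) `|interp_kernel n (th + grid_angle R n k)|.

(** A shift by one step trades the term at index 0 for the one at index [2 n], which is equal to it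
    by periodicity. *)
Lemma kernel_sumDgrid (R : realType) (n j : nat) (th : R) : (0 < n)%N ->
  kernel_sum n (th + grid_angle R n j) = kernel_sum n th.
Proof.
move=> n0; have nR : n%:R != 0 :> R by rewrite pnatr_eq0 -lt0n.
elim: j => [|j IH]; first by rewrite /grid_angle !mul0r addr0.
rewrite -IH; set x := th + grid_angle R n j.
have -> : th + grid_angle R n j.+1 = x + pi / n%:R.
  by rewrite /x /grid_angle -natr1; field.
pose g k := `|interp_kernel n (x + grid_angle R n k)|.
have gS k : `|interp_kernel n (x + pi / n%:R + grid_angle R n k)| = g k.+1.
  by rewrite /g /grid_angle -natr1; congr `|interp_kernel _ _|; field.
have g2n : g (n + n)%N = g 0%N.
  rewrite /g -[in RHS]interp_kernelD2pi; congr `|interp_kernel _ _|.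
  by rewrite /grid_angle natrD; field.
apply: (addrI (g 0%N)); rewrite /kernel_sum.
under eq_bigr do rewrite gS.
transitivity (\sum_(k < (n + n).+1) g k); first by rewrite big_ord_recl.
by rewrite big_ord_recr /= g2n addrC.
Qed.

(** For [k >= 1] the angle lies between [k pi / n] and [pi], so the decay bound gives at most
    [1 / (pi k)]; the harmonic sum does the rest. *)
Lemma kernel_half_sum_le (R : realType) (n : nat) (x : R) :
  (0 < n)%N -> 0 <= x -> x <= pi / n%:R ->
  \sum_(k < n) `|interp_kernel n (x + grid_angle R n k)| <=
  `|interp_kernel n x| + 2 / pi * ln n%:R.
Proof.
case: n => // n _ x0 xn.
have pi0 := pi_gt0 R.
have nR : 0 < n.+1%:R :> R by rewrite ltr0n.
rewrite big_ord_recl /= [in X in X + _]/grid_angle !mul0r addr0 lerD2l.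
have -> : 2 / pi * ln n.+1%:R = pi^-1 * (2 * ln n.+1%:R) :> R by ring.
apply: le_trans (ler_wpM2l (ltW _) (sum_harmonic_le_ln R n)); last first.
  by rewrite invr_gt0.
rewrite big_distrr /=; apply: ler_sum => k _.
rewrite /bump /= add1n.
have g0 : 0 < grid_angle R n.+1 k.+1.
  by rewrite /grid_angle divr_gt0 // mulr_gt0 // ltr0n.
apply: (le_trans (interp_kernel_le_inv _ _ _)) => //.
- by rewrite ltr_wpDl.
- apply: le_trans (lerD xn (lexx _)) _.
  rewrite /grid_angle -mulrDl ler_pdivrMr // -[X in X + _]mul1r -mulrDl.
  by rewrite [leRHS]mulrC ler_pM2r // nat1r ler_nat ltnS.
have kpi : 0 < pi * k.+1%:R :> R by rewrite mulr_gt0 // ltr0n.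
have xg : 0 < x + grid_angle R n.+1 k.+1 by rewrite ltr_wpDl.
rewrite -invfM lef_pV2 ?posrE ?(mulr_gt0 nR xg) //.
rewrite mulrDr -[leLHS]add0r lerD ?mulr_ge0 ?(ltW nR) //.
by rewrite /grid_angle [leRHS]mulrC divfK ?gt_eqF // mulrC.
Qed.

(* The reflection [t -> 2 pi - t] folds the upper half of the grid onto the
   lower half. *)
Lemma kernel_sum_split (R : realType) (n : nat) (th : R) : (0 < n)%N ->
  kernel_sum n th =
  \sum_(k < n) `|interp_kernel n (th + grid_angle R n k)| +
  \sum_(k < n) `|interp_kernel n (pi / n%:R - th + grid_angle R n k)|.
Proof.
move=> n0; have nR : n%:R != 0 :> R by rewrite pnatr_eq0 -lt0n.
rewrite /kernel_sum big_split_ord /=; congr (_ + _).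
rewrite (reindex_inj rev_ord_inj) /=; apply: eq_bigr => k _.
rewrite -interp_kernelN -interp_kernelD2pi; congr `|interp_kernel _ _|.
rewrite /grid_angle natrD natrB // -natr1.
by field.
Qed.

Lemma kernel_sum_le (R : realType) (n : nat) (th : R) : (0 < n)%N -> 0 <= th ->
  kernel_sum n th <= (1 + 2 / pi) * (ln n%:R + 1).
Proof.
move=> n0 th0.
have pi0 := pi_gt0 R.
have pi2 := pi_ge2 R.
have nR : 0 < n%:R :> R by rewrite ltr0n.
have n0' := lt0r_neq0 nR.
have := truncn_itv (x := th * n%:R / pi).
rewrite divr_ge0 ?mulr_ge0 ?(ltW pi0) ?(ltW nR) // => /(_ isT).
(* [j] is the index of the grid cell containing [th]; periodicity along the grid reduces to the
   first cell. *)
set j := Num.trunc _ => /andP[jle jlt].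
have {jle jlt} : 0 <= th - grid_angle R n j /\ th - grid_angle R n j <= pi / n%:R.
  rewrite /grid_angle subr_ge0 lerBlDr -mulrDl; split.
    by rewrite ler_pdivrMr // -ler_pdivlMr.
  rewrite ler_pdivlMr // -[X in X + _]mul1r -mulrDl nat1r -ler_pdivrMr //.
  exact: ltW.
rewrite -(subrK (grid_angle R n j) th) kernel_sumDgrid // addrK.
move: (th - _) => x [x0 xn].
have y0 : 0 <= pi / n%:R - x by rewrite subr_ge0.
have yn : pi / n%:R - x <= pi / n%:R by rewrite gerBl.
rewrite kernel_sum_split //.
have := lerD (kernel_half_sum_le n0 x0 xn) (kernel_half_sum_le n0 y0 yn).
move/le_trans; apply.
(* One of [x] and [pi / n - x] is at least half a step, where the kernel is at most [2 / pi]; the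
   other contributes at most 1. *)
have far (z : R) : pi / n%:R / 2 <= z -> z <= pi / n%:R ->
    `|interp_kernel n z| <= 2 / pi.
  move=> zh zn; have z0 : 0 < z.
    by apply: (lt_le_trans _ zh); apply: divr_gt0 => //; exact: divr_gt0.
  have zpi : z <= pi.
    apply: (le_trans zn); rewrite ler_pdivrMr // ler_peMr ?(ltW pi0) //.
    by rewrite ler1n.
  apply: (le_trans (interp_kernel_le_inv n0 z0 zpi)).
  rewrite -[2 / pi]invf_div lef_pV2 ?posrE ?mulr_gt0 ?divr_gt0 //.
  have -> : pi / 2 = n%:R * (pi / n%:R / 2) :> R by field.
  by rewrite ler_pM2l.
have K1 (z : R) : `|interp_kernel n z| <= 1 by exact: interp_kernel_le1.
have near_le : `|interp_kernel n x| + `|interp_kernel n (pi / n%:R - x)| <= 1 + 2 / pi.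
  have [xh|xh] := leP (pi / n%:R / 2) x.
    by rewrite addrC lerD // far.
  by rewrite lerD // far //; lra.
have ln0 : 0 <= ln n%:R :> R by rewrite ln_ge0 // ler1n.
(* The two halves give [4 / pi * ln n], which is absorbed in [(1 + 2 / pi) * ln n] because
   [2 / pi <= 1]. *)
have q1 : 2 / pi <= 1 :> R by rewrite ler_pdivrMr // mul1r.
nra.
Qed.

(** * Cosine polynomials and their control by grid values *)

(** As with [size], [n] counts coefficients: the frequencies stay below [n]. *)
Definition cosine_poly (R : realType) (n : nat) (f : R -> R) : Prop :=
  exists c : 'I_n -> R, forall t, f t = \sum_(m < n) c m * cos (m%:R * t).

Lemma cosine_poly0 (R : realType) (n : nat) : cosine_poly n (fun=> 0 : R).
Proof. by exists (fun=> 0) => t; rewrite big1 // => m _; rewrite mul0r. Qed.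

Lemma cosine_polyD (R : realType) (n : nat) (f g : R -> R) :
  cosine_poly n f -> cosine_poly n g ->
  cosine_poly n (fun t => f t + g t).
Proof.
move=> [c fE] [d gE]; exists (fun m => c m + d m) => t.
by rewrite fE gE -big_split; apply: eq_bigr => m _; rewrite /= mulrDl.
Qed.

Lemma cosine_polyZ (R : realType) (n : nat) (a : R) (f : R -> R) :
  cosine_poly n f -> cosine_poly n (fun t => a * f t).
Proof.
move=> [c fE]; exists (fun m => a * c m) => t.
by rewrite fE big_distrr; apply: eq_bigr => m _; rewrite /= mulrA.
Qed.

Lemma cosine_poly_cos (R : realType) (n m : nat) : (m < n)%N ->
  cosine_poly n (fun t : R => cos (m%:R * t)).
Proof.
move=> mn; exists (fun i => (i == m :> nat)%:R) => t.
transitivity (\sum_(i < n) (i == m :> nat)%:R * cos (m%:R * t)).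
  by rewrite sum_nat_delta mn mul1r.
apply: eq_bigr => i _.
by have [->|] := eqVneq (i : nat) m; rewrite ?mul0r.
Qed.

Lemma cosine_poly_sum (R : realType) (n k : nat) (F : 'I_k -> R -> R) :
  (forall i, cosine_poly n (F i)) -> cosine_poly n (fun t => \sum_(i < k) F i t).
Proof.
move=> FP; have -> : (fun t => \sum_(i < k) F i t) = \sum_(i < k) F i.
  by apply/funext => t; rewrite fct_sumE.
elim/big_ind : _ => //; first exact: cosine_poly0.
by move=> f g; exact: cosine_polyD.
Qed.

Lemma cosine_poly_mul_cos (R : realType) (n : nat) (f : R -> R) : cosine_poly n f ->
  cosine_poly n.+1 (fun t => f t * cos t).
Proof.
move=> [c fE].
have -> : (fun t => f t * cos t) =
    (fun t => \sum_(m < n) c m * (cos (m%:R * t) * cos t)).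
  apply/funext => t; rewrite fE big_distrl.
  by apply: eq_bigr => m _; rewrite mulrA.
apply: cosine_poly_sum => -[[|m] mn]; apply: cosine_polyZ => /=.
  have -> : (fun t : R => cos (0%:R * t) * cos t) = (fun t => cos (1%:R * t)).
    by apply/funext => t; rewrite mul0r cos0 !mul1r.
  exact: cosine_poly_cos.
have -> : (fun t : R => cos (m.+1%:R * t) * cos t) =
    (fun t => 2^-1 * (cos (m.+2%:R * t) + cos (m%:R * t))).
  apply/funext => t; apply: (@mulfI _ 2) => //.
  rewrite mulr2_cos_cos mulrA divff // mul1r -!natr1.
  by congr (cos _ + cos _); ring.
by apply/cosine_polyZ/cosine_polyD; apply: cosine_poly_cos; lia.
Qed.

Lemma cosine_poly_horner (R : realType) (n : nat) (p : {poly R}) : (size p <= n)%N ->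
  cosine_poly n (fun t => p.[cos t]).
Proof.
elim/poly_ind: p n => [|p c IH] n.
  move=> _; have -> : (fun t : R => 0.[cos t]) = (fun=> 0); last exact: cosine_poly0.
  by apply/funext => t; rewrite horner0.
rewrite size_MXaddC; case: ifP => [/andP[/eqP-> /eqP->] _|_].
  have -> : (fun t : R => (0 * 'X + 0%:P).[cos t]) = (fun=> 0).
    by apply/funext => t; rewrite mul0r addr0 horner0.
  exact: cosine_poly0.
case: n => // n pn.
have -> : (fun t : R => (p * 'X + c%:P).[cos t]) =
    (fun t => p.[cos t] * cos t + c * cos (0%:R * t)).
  by apply/funext => t; rewrite hornerMXaddC mul0r cos0 mulr1.
by apply/cosine_polyD/cosine_polyZ/cosine_poly_cos => //; exact/cosine_poly_mul_cos/IH.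
Qed.

(** The kernel reproduces [q] from its values on the full grid, including frequency [n] since the
    phase is 0. As [q] is even and has period [2 pi], the angles with [j <= n] control all of these
    values. *)
Lemma cosine_poly_grid_le (R : realType) (n : nat) (q : R -> R) (A th : R) :
  (0 < n)%N -> cosine_poly n.+1 q ->
  (forall j, (j <= n)%N -> `|q (grid_angle R n j)| <= A) ->
  0 <= th -> `|q th| <= A * ((1 + 2 / pi) * (ln n%:R + 1)).
Proof.
move=> n0 [c qE] qA th0.
have nR : n%:R != 0 :> R by rewrite pnatr_eq0 -lt0n.
have A0 : 0 <= A by exact: le_trans (qA 0%N _).
have qk (k : 'I_(n + n)) : `|q (grid_angle R n k)| <= A.
  have [/qA//|nk] := leqP k n.
  have -> : q (grid_angle R n k) = q (grid_angle R n (n + n - k)).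
    rewrite !qE; apply: eq_bigr => m _; congr (_ * _).
    rewrite -cosN -(@cosD_natr_pi2 R _ m); congr cos.
    rewrite /grid_angle natrB ?natrD; last exact: ltnW.
    by field.
  by apply: qA; lia.
have -> : q th = \sum_(k < n + n)
    interp_kernel n (th + grid_angle R n k) * q (grid_angle R n k).
  under eq_bigr do rewrite qE big_distrr /=.
  rewrite exchange_big qE; apply: eq_bigr => m _ /=.
  under eq_bigr do rewrite mulrCA.
  rewrite -big_distrr; congr (_ * _).
  transitivity (\sum_(k < n + n) interp_kernel n (- th - grid_angle R n k) *
      cos (m%:R * grid_angle R n k + 0)); last first.
    apply: eq_bigr => k _.
    by rewrite -[in LHS]interp_kernelN opprB opprK (addrC th) addr0.
  rewrite interp_kernel_cos ?leq_ord // addr0 cos0 mulr1 !mulrN !cosN.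
  case: ifP => // mn; congr (cos (_%:R * _)).
  by have := ltn_ord m; lia.
apply: (le_trans (ler_norm_sum _ _ _)).
apply: (@le_trans _ _ (A * kernel_sum n th)).
  rewrite big_distrr; apply: ler_sum => k _.
  by rewrite normrM mulrC ler_wpM2r.
by rewrite ler_wpM2l // kernel_sum_le.
Qed.

(** * Lagrange polynomials and the self-bounding estimate *)

(** A formal version of [lagrange_basis], so that its degree can be bounded and [cos t]
    substituted. *)
Definition lagrange_poly (R : realType) (n : nat) (x : 'I_n.+1 -> R)
    (j : 'I_n.+1) : {poly R} :=
  \prod_(k < n.+1 | k != j) ((x j - x k)^-1 *: ('X - (x k)%:P)).

Lemma size_lagrange_poly (R : realType) (n : nat) (x : 'I_n.+1 -> R)
    (j : 'I_n.+1) : (size (lagrange_poly x j) <= n.+1)%N.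
Proof.
apply: (leq_trans (size_poly_prod_leq _ _)).
have cP : #|(fun k => k != j)| = n.
  by have := cardC1 j; rewrite card_ord.
rewrite cP leq_subLR.
apply: (@leq_ltn_trans (\sum_(k < n.+1 | k != j) 2)); last first.
  by rewrite sum_nat_const cP; lia.
apply: leq_sum => k _; apply: (leq_trans (size_scale_leq _ _)).
by rewrite size_XsubC.
Qed.

Lemma horner_lagrange_poly (R : realType) (n : nat) (x : 'I_n.+1 -> R)
    (j : 'I_n.+1) (t : R) : (lagrange_poly x j).[t] = lagrange_basis x j t.
Proof.
rewrite horner_prod; apply: eq_bigr => k _.
by rewrite hornerZ hornerXsubC mulrC.
Qed.

Lemma lagrange_basis_node (R : realType) (n : nat) (x : 'I_n.+1 -> R)
    (i j : 'I_n.+1) : injective x -> lagrange_basis x j (x i) = (i == j)%:R.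
Proof.
move=> xI; have [->|ij] := eqVneq i j.
  apply: big1 => k kj; apply: divff; rewrite subr_eq0.
  by apply: contra_neq kj => /xI.
by rewrite /lagrange_basis (bigD1 i) //= subrr !mul0r.
Qed.

(** The Lebesgue constant stands on both sides because it is itself the sup bound fed into
    Bernstein's inequality. *)
Lemma lebesgue_constant_perturbed_le (R : realType) (n : nat)
    (eps : 'I_n.+1 -> R) (sigma : R) :
  (0 < n)%N -> admissible_perturbation eps sigma ->
  lebesgue_constant (perturbed_node eps) <=
    (1 + n%:R * sigma * lebesgue_constant (perturbed_node eps)) *
    ((1 + 2 / pi) * (ln n%:R + 1)).
Proof.
move=> n0 [_ _ eps_le xI]; set x := perturbed_node eps.
have [c c11 [-> cmax]] := lebesgue_constant_max x.
set L := lebesgue_function x c.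
pose s j := Num.sg (lagrange_basis x j c).
pose p := \sum_j s j *: lagrange_poly x j.
have pE t : p.[t] = \sum_j s j * lagrange_basis x j t.
  rewrite horner_sum; apply: eq_bigr => j _.
  by rewrite hornerZ horner_lagrange_poly.
have s1 j : `|s j| <= 1 by rewrite normr_sg lern1 leq_b1.
have pc : p.[c] = L by rewrite pE; apply: eq_bigr => j _; rewrite normrEsg.
have px i : p.[x i] = s i.
  rewrite pE (bigD1 i) //= lagrange_basis_node // eqxx mulr1 big1 ?addr0 // => j.
  by rewrite lagrange_basis_node // eq_sym => /negbTE->; rewrite mulr0.
have pL t : t \in `[-1, 1] -> `|p.[t]| <= L.
  move=> /cmax; apply: le_trans; rewrite pE.
  apply: (le_trans (ler_norm_sum _ _ _)); apply: ler_sum => j _.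
  by rewrite normrM ler_piMl.
have psize : (size p <= n.+1)%N.
  apply: (leq_trans (size_sum _ _ _)); apply/bigmax_leqP => j _.
  exact: (leq_trans (size_scale_leq _ _) (size_lagrange_poly x j)).
have qcos := cosine_poly_horner psize.
have L0 : 0 <= L by apply: sumr_ge0.
have qL t : `|p.[cos t]| <= L by apply: pL; rewrite in_itv /= cos_geN1 cos_le1.
have c11' : -1 <= c <= 1 by move: c11; rewrite in_itv.
(* The maximum is the value of [t -> p (cos t)] at [acos c], so it suffices to bound this function
   at the grid angles. *)
rewrite -[leLHS]ger0_norm // -[in leLHS]pc -(acosK c11).
apply: (cosine_poly_grid_le n0 qcos); last exact: acos_ge0.
move=> j jn; pose i : 'I_n.+1 := inord j.
have ij : i = j :> nat by rewrite inordK.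
have [d qE] := qcos.
have := cosine_poly_lipschitz (grid_angle R n j) (eps i) n0 qE qL.
have -> : p.[cos (grid_angle R n j + eps i)] = s i.
  by rewrite -px /x /perturbed_node ij.
(* The grid value is the nodal value [s i], of modulus at most 1, minus an increment over the angle
   [eps i]. *)
move=> lip; rewrite -[p.[_]](subKr (s i)).
apply: (le_trans (ler_normB _ _)); apply: lerD => //.
apply: (le_trans lip); rewrite ler_wpM2r // ler_wpM2l //.
Qed.

(** * The explicit bound and its asymptotic consequence *)

Theorem theorem3p2 (R : realType) :
  (forall (n : nat) (eps : 'I_n.+1 -> R) (sigma eta : R),
     (1 <= n)%N ->
     admissible_perturbation eps sigma ->
     0 < eta -> eta < (1 + 2 / pi)^-1 ->
     n%:R * sigma * (ln n%:R + 1) <= eta ->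
     lebesgue_constant (perturbed_node eps) <=
       (1 + 2 / pi) / (1 - (1 + 2 / pi) * eta) * (ln n%:R + 1))
  /\
  (forall (eps : forall n : nat, 'I_n.+1 -> R) (sigma : nat -> R),
     (forall n : nat, (1 <= n)%N ->
        admissible_perturbation (eps n) (sigma n)) ->
     (n%:R * sigma n * ln n%:R) @[n --> \oo] --> (0 : R) ->
     (fun n : nat => lebesgue_constant (perturbed_node (eps n)) : R^o)
       =O_\oo (fun n : nat => ln n%:R : R^o)).
Proof.
have pi0 := pi_gt0 R; have pi2 := pi_ge2 R.
have b0 : 0 < 1 + 2 / pi :> R by rewrite addr_gt0 // divr_gt0.
have b2 : 1 + 2 / pi <= 2 :> R.
  by rewrite -lerBrDl ler_pdivrMr //; lra.
have part1 (n : nat) (eps : 'I_n.+1 -> R) (sigma eta : R) : (1 <= n)%N ->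
    admissible_perturbation eps sigma ->
    0 < eta -> eta < (1 + 2 / pi)^-1 ->
    n%:R * sigma * (ln n%:R + 1) <= eta ->
    lebesgue_constant (perturbed_node eps) <=
      (1 + 2 / pi) / (1 - (1 + 2 / pi) * eta) * (ln n%:R + 1).
  move=> n0 adm eta0 eta_lt small.
  have := lebesgue_constant_perturbed_le n0 adm.
  have L0 : 0 <= lebesgue_constant (perturbed_node eps).
    have [c _ [-> _]] := lebesgue_constant_max (perturbed_node eps).
    exact: sumr_ge0.
  move: (lebesgue_constant _) L0 => L L0 LE.
  have den : 0 < 1 - (1 + 2 / pi) * eta.
    by rewrite subr_gt0 mulrC -ltr_pdivlMr // mul1r.
  (* Solve for [L]: the smallness hypothesis turns the term containing [L] on the right into at most
     [(1 + 2 / pi) * eta * L]. *)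
  rewrite mulrAC ler_pdivlMr // mulrBr mulr1 lerBlDr.
  apply: (le_trans LE); rewrite mulrDl mul1r lerD2l.
  have -> : n%:R * sigma * L * ((1 + 2 / pi) * (ln n%:R + 1)) =
    L * ((1 + 2 / pi) * (n%:R * sigma * (ln n%:R + 1))) by ring.
  by rewrite ler_wpM2l // ler_wpM2l // ltW.
split=> // eps sigma adm cvg0.
apply/eqOP; near=> k; near=> n.
have n0 : (0 < n)%N by near: n; exact: nbhs_infty_ge.
have [_ _ /(_ ord0)/(le_trans (normr_ge0 _)) sigma0 _] := adm n n0.
have ln1 : 1 <= ln n%:R :> R.
  rewrite -[leLHS]expRK ler_ln ?posrE ?expR_gt0 ?ltr0n //.
  apply: (@le_trans _ _ (Num.trunc (expR 1 : R)).+1%:R).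
    by have /andP[_ /ltW] := truncn_itv (expR_ge0 (1 : R)).
  by rewrite ler_nat; near: n; exact: nbhs_infty_ge.
(* The choice [eta = 1 / 4] is allowed as [1 + 2 / pi <= 2]. Since [ln n >= 1], both summands are
   eventually below [1 / 8]. *)
have small : n%:R * sigma n * (ln n%:R + 1) <= 4^-1.
  have : `|n%:R * sigma n * ln n%:R| < 8^-1.
    by near: n; apply: cvgr0_norm_lt => //; rewrite invr_gt0.
  move=> /(le_lt_trans (ler_norm _)) lt8.
  have : n%:R * sigma n * 1 <= n%:R * sigma n * ln n%:R.
    by rewrite ler_wpM2l // mulr_ge0.
  lra.
have := part1 n (eps n) (sigma n) 4^-1 n0 (adm n n0) _ _ small.
have -> : 4^-1 < (1 + 2 / pi)^-1 :> R.
  by rewrite ltf_pV2 ?posrE //; lra.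
rewrite invr_gt0 ltr0n => /(_ isT isT) le1.
have L0 : 0 <= lebesgue_constant (perturbed_node (eps n)).
  have [c _ [-> _]] := lebesgue_constant_max (perturbed_node (eps n)).
  exact: sumr_ge0.
rewrite [leLHS]ger0_norm // [X in _ * X]ger0_norm; last by apply: le_trans ln1.
apply: (le_trans le1).
(* From [1 + 2 / pi <= 2] the constant is at most [2 / (1 - 2 / 4) = 4]; then [1 <= ln n] gives the
   factor 8. *)
apply: (@le_trans _ _ (4 * (ln n%:R + 1))).
  apply: ler_wpM2r; first lra.
  by rewrite ler_pdivrMr; lra.
apply: (@le_trans _ _ (8 * ln n%:R)); first lra.
apply: ler_wpM2r; first exact: le_trans ln1.
by near: k; apply: nbhs_pinfty_ge; rewrite num_real.
Unshelve. all: by end_near.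
Qed.
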